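(* Let $r\ge2$ and $n\ge 1$. With $T_{n,\ell}^{(r)}$ the number of paths in $\mathcal{A}_{n,0}^{(r)}$ containing exactly $\ell$ occurrences of $\mathbf{udu}$ and $S_n^{(r)}=|\mathcal{A}_{n,0}^{(r)}|$, $$\sum_{\ell=1}^{n}\ell\,T_{n+1,\ell}^{(r)}=rnS_n^{(r)}.$$
   Context: A Dyck path of length $2n$ is a lattice path from $(0,0)$ to $(2n,0)$ weakly above the $x$-axis with steps $\mathbf{u}=(1,1)$, $\mathbf{d}=(1,-1)$; an $r$-colored Dyck path has each $\mathbf{d}$-step colored with one of $r$ colors. $\mathcal{A}_{n,0}^{(r)}$ is the set of $r$-colored Dyck paths of length $2n$ with no two consecutive $\mathbf{d}$-steps of the same color. An occurrence of $\mathbf{udu}$ is a triple of consecutive steps of the form $\mathbf{u},\mathbf{d},\mathbf{u}$ (colors ignored); occurrences may overlap. *)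

(* Defs.v *)
From mathcomp Require Import all_boot all_order all_algebra.

Set Implicit Arguments.
Unset Strict Implicit.
Unset Printing Implicit Defensive.

(* None is the up-step u = (1,1); Some c is the down-step d = (1,-1) with
   colour c. A path is the sequence of its steps, starting at height 0. *)
Notation step r := (option 'I_r).

Definition is_up (r : nat) (x : step r) : bool := x == None.

Definition height (r : nat) (s : seq (step r)) : int :=
  (\sum_(x <- s) (if is_up x then 1 else -1))%R.

Definition dyck (r : nat) (s : seq (step r)) : bool :=
  (height s == 0)%R && all (fun i => (0 <= height (take i s))%R) (iota 0 (size s).+1).

(* Equal adjacent steps that are not up-steps are two consecutive down-steps
   of the same colour. *)
Definition no_mono_dd (r : nat) (s : seq (step r)) : bool :=
  sorted (fun x y => is_up x || (x != y)) s.

Definition A0 (r n : nat) : {set n.*2.-tuple (step r)} :=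
  [set w : n.*2.-tuple (step r) | dyck w && no_mono_dd w].

(* Number of positions i at which u, d, u occur as steps i, i+1, i+2. *)
Definition udu (r : nat) (s : seq (step r)) : nat :=
  count (fun i => prefix [:: true; false; true] (drop i (map (@is_up r) s)))
        (iota 0 (size s)).

Definition numT (r n l : nat) : nat := #|[set w in A0 r n | udu w == l]|.

Definition numS (r n : nat) : nat := #|A0 r n|.

(* Main.v *)
(** Pairs (path in A0 r n.+1, marked occurrence of udu) are in bijection with
    triples (path in A0 r n, marked up-step, colour c): insert [d_c u] right
    after the marked up-step.  An inserted down-step is surrounded by up-steps,
    so neither nonnegativity nor the colour condition is affected, and a path
    in A0 r n has exactly n up-steps. *)
Require Import Defs.
From mathcomp Require Import all_boot all_order all_algebra.
From mathcomp Require Import zify.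

Set Implicit Arguments.
Unset Strict Implicit.
Unset Printing Implicit Defensive.

Import GRing.Theory.

Section Steps.

Variable r : nat.
Implicit Types (s a b : seq (step r)) (c : 'I_r).

Lemma height_cons (x : step r) s :
  height (x :: s) = ((if is_up x then 1 else -1) + height s)%R.
Proof. by rewrite /height big_cons. Qed.

Lemma height_count_up s :
  height s = ((count (@is_up r) s).*2%:Z - (size s)%:Z)%R.
Proof.
elim: s => [|x s IHs]; first by rewrite /height big_nil.
by rewrite height_cons IHs /=; case: (is_up x) => /=; lia.
Qed.

(** The free starting height [h] makes nonnegativity amenable to induction on the steps; [dyck] uses
    it at [h = 0]. *)
Definition nneg_from (h : int) s : bool :=
  all (fun i => (0 <= h + height (take i s))%R) (iota 0 (size s).+1).

Lemma nneg_from_cons h (x : step r) s :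
  nneg_from h (x :: s) =
  (0 <= h)%R && nneg_from (h + (if is_up x then 1 else -1))%R s.
Proof.
have iota_S : iota 0 (size (x :: s)).+1 = 0 :: map S (iota 0 (size s).+1).
  by rewrite -[map S _](iotaDl 1 0).
rewrite /nneg_from iota_S; move: (iota 0 (size s).+1) => l /=.
rewrite {1}/height big_nil addr0 all_map; congr andb.
by apply: eq_all => i /=; rewrite height_cons addrA.
Qed.

Lemma nneg_from_ge0 h s : nneg_from h s -> (0 <= h)%R.
Proof. by rewrite /nneg_from /= take0 /height big_nil addr0 => /andP[]. Qed.

(** After [a] at height [h], the inserted pair only revisits [h] and [h + 1], both already reached
    around the original up-step. *)
Lemma nneg_from_insert h a b c :
  nneg_from h (a ++ [:: None, Some c, None & b]) = nneg_from h (a ++ None :: b).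
Proof.
elim: a h => [|x a IHa] h; last by rewrite /= !nneg_from_cons IHa.
rewrite /= !nneg_from_cons /= subrK addrK.
by case: (boolP (nneg_from _ b)) => [/nneg_from_ge0|]; lia.
Qed.

Lemma dyck_insert a b c :
  dyck (a ++ [:: None, Some c, None & b]) = dyck (a ++ None :: b).
Proof.
have dyckE s : dyck s = (height s == 0)%R && nneg_from 0 s.
  by rewrite /dyck /nneg_from; congr andb; apply: eq_all => i; rewrite add0r.
rewrite !dyckE nneg_from_insert; congr andb.
(* One more up-step and two more steps leave the final height unchanged. *)
by rewrite !height_count_up !count_cat !size_cat /=; lia.
Qed.

Lemma no_mono_dd_insert a b c :
  no_mono_dd (a ++ [:: None, Some c, None & b]) = no_mono_dd (a ++ None :: b).
Proof. by rewrite /no_mono_dd; case: a => [|x a] //=; rewrite !cat_path. Qed.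

Definition udu_at s i : bool :=
  prefix [:: true; false; true] (drop i (map (@is_up r) s)).

Lemma udu_sum s : udu s = \sum_(i < size s) udu_at s i.
Proof.
by rewrite /udu -sum1_count big_mkcond -[X in iota 0 X]subn0 big_mkord;
  apply: eq_bigr => i _; rewrite /udu_at; case: prefix.
Qed.

(** Distinct occurrences start at distinct up-steps, and the last up-step starts none. *)
Lemma udu_le s : udu s <= (count (@is_up r) s).-1.
Proof.
elim: s => [|x s IHs] //.
have -> : udu (x :: s) = udu_at (x :: s) 0 + udu s.
  by rewrite !udu_sum big_ord_recl.
case E: (udu_at _ _); last by move: IHs => /=; lia.
(* An occurrence at the head puts an up-step in the tail, so [.-1] does not truncate there. *)
suff: 0 < count (@is_up r) s.
  by move: E IHs; rewrite /udu_at /=; case: (is_up x) => //=; lia.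
move: E; rewrite /udu_at /=; case: s {IHs} => [|y [|z s]] //=; case: (is_up x) => //=.
  by case: (is_up y).
by case: (is_up y); case: (is_up z).
Qed.

Lemma udu_at_cat a b c : udu_at (a ++ [:: None, Some c, None & b]) (size a).
Proof. by rewrite /udu_at -map_drop drop_size_cat //= prefix0s. Qed.

Lemma udu_atP s i : udu_at s i ->
  exists a b c, s = a ++ [:: None, Some c, None & b] /\ size a = i.
Proof.
rewrite /udu_at -map_drop => H; exists (take i s); move: H.
case E: (drop i s) => [|[?|] [|[c|] [|[?|] b]]] //= _; exists b, c.
split; first by rewrite -E cat_take_drop.
by rewrite size_takel // leqNgt; apply/negP => /ltnW /drop_oversize; rewrite E.
Qed.

Lemma upP s i : i < size s -> is_up (nth None s i) ->
  exists a b, s = a ++ None :: b /\ size a = i.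
Proof.
move=> lt_i /eqP up_i; exists (take i s), (drop i.+1 s).
by rewrite -up_i -drop_nth // cat_take_drop size_takel // ltnW.
Qed.

(** Cutting by position makes the map total, whether or not step [i] is an up-step; [i.+1] keeps
    step [i] before the insertion. *)
Definition insert_du s i c : seq (step r) :=
  take i.+1 s ++ [:: Some c, None & drop i.+1 s].

Lemma insert_du_cat a b c :
  insert_du (a ++ None :: b) (size a) c = a ++ [:: None, Some c, None & b].
Proof.
rewrite /insert_du -(cat_rcons None a b) -(size_rcons a None) take_size_cat //.
by rewrite drop_size_cat // cat_rcons.
Qed.

Lemma size_insert_du s i c : size (insert_du s i c) = (size s).+2.
Proof.
by rewrite size_cat /= !addnS -size_cat cat_take_drop.
Qed.

End Steps.

Lemma count_up_A0 r n (w : n.*2.-tuple (step r)) :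
  w \in A0 r n -> count (@is_up r) w = n.
Proof.
rewrite inE => /andP[/andP[/eqP + _] _].
by rewrite height_count_up size_tuple; lia.
Qed.

Lemma udu_A0_le r n (w : n.+1.*2.-tuple (step r)) : w \in A0 r n.+1 -> udu w <= n.
Proof. by move=> wA; have := udu_le w; rewrite (count_up_A0 wA). Qed.

Section MarkedPaths.

Variables r n : nat.

Definition marked_udu : {set n.+1.*2.-tuple (step r) * 'I_n.+1.*2} :=
  [set p : _ * 'I__ | (p.1 \in A0 r n.+1) && udu_at p.1 p.2].

(** The default [None] would count as an up-step, but the index type keeps [nth] within the path. *)
Definition marked_up : {set n.*2.-tuple (step r) * 'I_n.*2 * 'I_r} :=
  [set q : _ * 'I__ * 'I__ | (q.1.1 \in A0 r n) && is_up (nth None q.1.1 q.1.2)].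

Lemma sum_numT :
  \sum_(1 <= l < n.+1) l * numT r n.+1 l = \sum_(w in A0 r n.+1) udu w.
Proof.
(* Paths are grouped by number of occurrences; [inord] is faithful here because that number is at
   most [n]. *)
rewrite (partition_big (fun w => inord (udu (tval w)) : 'I_n.+1) predT) //=.
transitivity (\sum_(l < n.+1) l * numT r n.+1 l).
  (* The extra term [l = 0] vanishes. *)
  by rewrite -(big_mkord predT (fun l => l * numT r n.+1 l)) [RHS]big_ltn.
apply: eq_bigr => l _; rewrite mulnC -sum_nat_const.
have udu_inord w : w \in A0 r n.+1 -> (inord (udu w) == l) = (udu w == l).
  by move=> /udu_A0_le le_n; rewrite -val_eqE /= inordK.
apply: esym; apply: eq_big => [w|w /andP[wA]].
  by rewrite inE; case: (boolP (w \in _)) => //= /udu_inord.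
by rewrite udu_inord // => /eqP.
Qed.

Lemma card_marked_udu : #|marked_udu| = \sum_(w in A0 r n.+1) udu w.
Proof.
transitivity (\sum_(w in A0 r n.+1) \sum_(i < n.+1.*2 | udu_at w i) 1).
  by rewrite pair_big_dep -sum1_card; apply: eq_bigl => p; rewrite inE.
by apply: eq_bigr => w _; rewrite udu_sum size_tuple big_mkcond;
  apply: eq_bigr => i _; case: udu_at.
Qed.

Lemma card_marked_up : #|marked_up| = r * n * numS r n.
Proof.
transitivity (\sum_(w in A0 r n) \sum_(i < n.*2 | is_up (nth None w i))
                \sum_(c < r) 1).
  rewrite pair_big_dep pair_big_dep -sum1_card.
  by apply: eq_bigl => q; rewrite inE andbT.
rewrite [RHS]mulnC /numS -sum_nat_const; apply: eq_bigr => w wA.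
rewrite sum_nat_const sum1_card card_ord mulnC; congr (r * _).
rewrite -sum1_card -[RHS](count_up_A0 wA) -sum1_count (big_nth None) size_tuple.
by rewrite big_mkord.
Qed.

Lemma insert_du_tupleP (w : n.*2.-tuple (step r)) i c :
  size (insert_du w i c) == n.+1.*2.
Proof. by rewrite size_insert_du size_tuple. Qed.

Lemma lift_posP (i : 'I_n.*2) : i < n.+1.*2.
Proof. by rewrite doubleS ltnW // ltnW // !ltnS. Qed.

(** The marked up-step becomes the first step of the marked occurrence, so its index is kept. *)
Definition mark_insert (q : n.*2.-tuple (step r) * 'I_n.*2 * 'I_r) :
    n.+1.*2.-tuple (step r) * 'I_n.+1.*2 :=
  (Tuple (insert_du_tupleP q.1.1 q.1.2 q.2), Ordinal (lift_posP q.1.2)).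

(** The kept index locates the two inserted steps: the first gives the colour, and deleting both
    restores the path. *)
Lemma mark_insert_inj : injective mark_insert.
Proof.
move=> [[w i] c] [[w' i'] c'] [] /= /[swap] /val_inj <- {i'}.
have size_take_w (v : n.*2.-tuple (step r)) : size (take i.+1 v) = i.+1.
  by rewrite size_takel // size_tuple.
move/eqP; rewrite eqseq_cat ?size_take_w //.
case/andP=> /eqP eq_take /eqP[<- eq_drop]; do 2 congr pair; apply: val_inj.
by rewrite /= -(cat_take_drop i.+1 w) eq_take eq_drop cat_take_drop.
Qed.

Lemma mark_insert_image : mark_insert @: marked_up = marked_udu.
Proof.
apply/setP=> p; apply/imsetP/idP => [[[[w i] c]]|].
  rewrite inE /= => /andP[wA up_i] ->.
  have lt_i : i < size w by rewrite size_tuple.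
  have [a [b [w_ab size_a]]] := upP lt_i up_i.
  move: wA; rewrite !inE /= -size_a w_ab insert_du_cat.
  by rewrite dyck_insert no_mono_dd_insert udu_at_cat => ->.
case: p => w i; rewrite inE /= => /andP[wA /udu_atP[a [b [c [w_abc size_a]]]]].
(* The preimage deletes the last two steps of the marked occurrence. *)
have size_v : size (a ++ None :: b) == n.*2.
  by have := size_tuple w; rewrite w_abc !size_cat /=; lia.
have lt_i : i < n.*2.
  by rewrite -(eqP size_v) size_cat /= -size_a; lia.
exists (Tuple size_v, Ordinal lt_i, c).
  move: wA; rewrite !inE w_abc dyck_insert no_mono_dd_insert /= => ->.
  by rewrite -size_a nth_cat ltnn subnn.
by congr pair; apply: val_inj => //=; rewrite -size_a insert_du_cat.
Qed.

End MarkedPaths.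

Theorem theorem6p2 (r n : nat) (hr : 2 <= r) (hn : 1 <= n) :
  \sum_(1 <= l < n.+1) l * numT r n.+1 l = r * n * numS r n.
Proof.
rewrite sum_numT -card_marked_udu -card_marked_up -mark_insert_image.
by rewrite card_imset //; exact: mark_insert_inj.
Qed.
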